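(* Let $f\in\mathcal{A}$, and let $\alpha,\beta,\gamma$ be real numbers with $0\leq\alpha<1$ and $\beta+2\gamma\geq 0$. If $$\left|\frac{zf'(z)}{f(z)}-1\right|^{\beta}\left|z\left(\frac{zf'(z)}{f(z)}\right)'\right|^{\gamma}<\left(\frac{1}{2}\right)^{\gamma}(1-\alpha)^{\beta+\gamma}\qquad\text{for all } z\in\mathbb{U},$$ then $f\in\mathcal{S}^{*}(\alpha)$, i.e. $\mathrm{Re}\left(\frac{zf'(z)}{f(z)}\right)>\alpha$ for all $z\in\mathbb{U}$.
   Context: $\mathbb{U}=\{z\in\mathbb{C}:|z|<1\}$ is the open unit disk. $\mathcal{A}$ is the class of functions $f$ analytic in $\mathbb{U}$ with $f(0)=0$ and $f'(0)=1$. The function $\frac{zf'(z)}{f(z)}$ has a removable singularity at $z=0$, where it takes the value $1$. For $0\leq\alpha<1$, $\mathcal{S}^{*}(\alpha)=\{f\in\mathcal{A}:\mathrm{Re}(zf'(z)/f(z))>\alpha \text{ for all } z\in\mathbb{U}\}$. The prime in $\left(\frac{zf'(z)}{f(z)}\right)'$ denotes differentiation with respect to $z$.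
   Formalization: The bound is required to be meaningful, i.e. |z(zf'/f)'| nonzero wherever γ<0; as it vanishes at z=0 this excludes γ<0, where the claim fails if z=0 is ignored (e.g. α=0, β=2, γ=-1, f=z·exp(2z²)). *)

(* Defs.v *)
From Stdlib Require Import Reals.
From Coquelicot Require Import Coquelicot.
Open Scope R_scope.

Definition unit_disk (z : C) : Prop := Cmod z < 1.

Definition analytic_at (f : C -> C) (z0 : C) : Prop :=
  exists (a : nat -> C) (r : R), 0 < r /\
    forall z : C, Cmod (z - z0) < r ->
      @is_pseries C_AbsRing C_NormedModule a (z - z0)%C (f z).

(* Only the values of f on the unit disk matter: the disk is open and the
   derivatives taken below are local. *)
Definition class_A (f : C -> C) : Prop :=
  (forall z : C, unit_disk z -> analytic_at f z) /\
  f (RtoC 0) = RtoC 0 /\ C_derive f (RtoC 0) = RtoC 1.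

(* z f'(z) / f(z), with its removable singularity at 0 filled in.  At a zero
   z <> 0 of f this is 0 (division by zero in C), so membership in
   [starlike_of_order alpha] with 0 <= alpha still excludes such zeros. *)
Definition log_ratio (f : C -> C) (z : C) : C :=
  if Ceq_dec z (RtoC 0) then RtoC 1 else (z * C_derive f z / f z)%C.

Definition starlike_of_order (alpha : R) (f : C -> C) : Prop :=
  class_A f /\
  forall z : C, unit_disk z -> alpha < Re (log_ratio f z).

(* Real power of a nonnegative base: 0^0 = 1 and 0^y = 0 for y > 0, where
   [Rpower 0 y] would be 1.  For y < 0, 0^y has no value; the total function
   returns 0 there, and [rpow_defined] singles out the legitimate arguments. *)
Definition rpow (x y : R) : R :=
  if Req_dec_T x 0 then (if Req_dec_T y 0 then 1 else 0) else Rpower x y.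

(* In the condition
     |p - 1|^beta |z p'|^gamma < (1/2)^gamma (1 - alpha)^(beta + gamma),
   with p = z f'/f, the power of |z p'| has to be meaningful.  This matters
   for gamma < 0: dropping it, or filling in the value at z = 0 by continuity,
   admits f(z) = z exp(2 z^2), for which p = 1 + 4 z^2.  With alpha = 0,
   beta = 2, gamma = -1 the left side is 2 |z|^2 < 2 for every z <> 0 in the
   disk, although Re p < 0 at some points.

   For |p - 1|^beta the requirement can be left out: if beta < 0 and p(z) = 1,
   the left side computed with [rpow] is 0 and nothing is imposed at z.  The
   resulting condition is weaker than the one that makes |p - 1|^beta
   meaningful everywhere and, for gamma >= 0, than the one that fills in
   values by continuity. *)
Definition rpow_defined (x y : R) : Prop := y < 0 -> x <> 0.

(* Main.v *)
Require Import Defs.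
From Stdlib Require Import Reals Lra Lia Psatz List ClassicalEpsilon.
From Coquelicot Require Import Coquelicot.
Open Scope R_scope.

(* Put p = z f'/f and c = 2 (1 - alpha).  At z = 0 the base |z p'| vanishes, so
   the hypothesis forces gamma >= 0.  If Re p > alpha fails, let z0 be a point
   of smallest modulus rho with Re p(z0) <= alpha.  On the ray towards z0 the
   modulus |f| increases, hence f(z0) <> 0 and p is analytic at z0.  The
   function w = (p - 1) / (p - 1 + c) maps |z| < rho into the unit disk and
   fixes 0, so |w(z)| <= |z| / rho by Schwarz.  Comparing first-order terms at
   z0 along the ray gives |p(z0) - 1|^2 <= c |z0 p'(z0)|, and since
   |p(z0) - 1| >= 1 - alpha this contradicts the hypothesis at z0.

   Writing f = z q, one has p - 1 = z q'/q, so w / z = q' / (z q' + c q) has no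
   singularity at 0 and the maximum principle applies to it directly. *)

(** The constant c comes from a reflection: 1 - c = 2 alpha - 1 is the mirror image of 1 in the line
    Re p = alpha, so |w| < 1 says exactly that p lies on the side of 1, that is Re p > alpha. With a
    = 1 - alpha, the bound |p - 1|^2 <= 2 a |z p'| at z0 gives |p - 1|^beta |z p'|^gamma >= |p -
    1|^(beta + 2 gamma) (2 a)^(-gamma) >= (1/2)^gamma a^(beta + gamma). The last step uses |p - 1|
    >= a and beta + 2 gamma >= 0; the factor (1/2)^gamma of the hypothesis is the 2 in c. The
    obstacle is that analyticity is given by local power series while p and w / z are quotients.
    Instead of dividing power series, the proof passes to finite Taylor expansions, which survive
    division, and derives the maximum principle from them. Order 3 is what that principle consumes:
    a mean over four points handles all terms up to the quadratic ones, and a cubic remainder loses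
    against a quadratic gain. *)

(** * Finite Taylor expansions and their algebra *)

Lemma Cmod_triangle_minus (x y : C) : Cmod (x - y) <= Cmod x + Cmod y.
Proof. unfold Cminus. rewrite <- (Cmod_opp y). apply Cmod_triangle. Qed.

(* A Taylor expansion of order n at 0 with bounded remainder, in Horner form:
   closure under sums, products and inverses is then a plain induction. *)
Fixpoint jet (n : nat) (g : C -> C) : Prop :=
  match n with
  | O => exists K d : R, 0 < d /\ forall h, Cmod h < d -> Cmod (g h) <= K
  | S m => exists (a : C) (g1 : C -> C), jet m g1 /\
      exists d : R, 0 < d /\
        forall h, Cmod h < d -> g h = (a + h * g1 h)%C
  end.

Lemma jet_ext (n : nat) (g k : C -> C) (d : R) :
  0 < d -> (forall h, Cmod h < d -> g h = k h) -> jet n g -> jet n k.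
Proof.
  intros hd e; destruct n as [|n]; simpl.
  - intros (K & d' & hd' & H). exists K, (Rmin d d'); split.
    + now apply Rmin_pos.
    + intros h hh. rewrite <- e by (eapply Rlt_le_trans; [exact hh|apply Rmin_l]).
      apply H. eapply Rlt_le_trans; [exact hh|apply Rmin_r].
  - intros (a & g1 & H1 & d' & hd' & H). exists a, g1; split; [exact H1|].
    exists (Rmin d d'); split.
    + now apply Rmin_pos.
    + intros h hh. rewrite <- e by (eapply Rlt_le_trans; [exact hh|apply Rmin_l]).
      apply H. eapply Rlt_le_trans; [exact hh|apply Rmin_r].
Qed.

Lemma jet_pred (n : nat) : forall g, jet (S n) g -> jet n g.
Proof.
  induction n as [|n IH]; intros g (a & g1 & H1 & d & hd & H).
  - destruct H1 as (K & d' & hd' & H1).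
    exists (Cmod a + 1 * Rmax K 0), (Rmin 1 (Rmin d d')); split.
    + repeat apply Rmin_pos; lra.
    + intros h hh.
      assert (h1 : Cmod h < 1) by (eapply Rlt_le_trans; [exact hh|apply Rmin_l]).
      assert (h2 : Cmod h < Rmin d d')
        by (eapply Rlt_le_trans; [exact hh|apply Rmin_r]).
      rewrite H by (eapply Rlt_le_trans; [exact h2|apply Rmin_l]).
      eapply Rle_trans; [apply Cmod_triangle|]. apply Rplus_le_compat_l.
      rewrite Cmod_mult. apply Rmult_le_compat; try apply Cmod_ge_0; try lra.
      eapply Rle_trans; [|apply Rmax_l]. apply H1.
      eapply Rlt_le_trans; [exact h2|apply Rmin_r].
  - exists a, g1; split; [now apply IH|]. now exists d.
Qed.

Lemma jet_const (n : nat) (c : C) : jet n (fun _ => c).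
Proof.
  revert c; induction n as [|n IH]; intro c; simpl.
  - exists (Cmod c), 1; split; [lra|]. intros; lra.
  - exists c, (fun _ => RtoC 0); split; [apply IH|].
    exists 1; split; [lra|]. intros; ring.
Qed.

Lemma jet_id (n : nat) : jet n (fun h => h).
Proof.
  destruct n as [|n]; simpl.
  - exists 1, 1; split; [lra|]. intros; lra.
  - exists (RtoC 0), (fun _ => RtoC 1); split; [apply jet_const|].
    exists 1; split; [lra|]. intros; ring.
Qed.

Lemma jet_plus (n : nat) :
  forall g k, jet n g -> jet n k -> jet n (fun h => g h + k h)%C.
Proof.
  induction n as [|n IH]; intros g k.
  - intros (K & d & hd & H) (K' & d' & hd' & H').
    exists (K + K'), (Rmin d d'); split; [now apply Rmin_pos|].
    intros h hh. eapply Rle_trans; [apply Cmod_triangle|].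
    apply Rplus_le_compat; [apply H|apply H'];
      eapply Rlt_le_trans; try exact hh; [apply Rmin_l|apply Rmin_r].
  - intros (a & g1 & H1 & d & hd & H) (b & k1 & H1' & d' & hd' & H').
    exists (a + b)%C, (fun h => g1 h + k1 h)%C; split; [now apply IH|].
    exists (Rmin d d'); split; [now apply Rmin_pos|].
    intros h hh. rewrite H, H'; [ring| |];
      eapply Rlt_le_trans; try exact hh; [apply Rmin_r|apply Rmin_l].
Qed.

(** The product is split asymmetrically, (a + h g1) k = a b + h (a k1 + g1 k), so that the tail only
    needs [k] itself at one order less. *)
Lemma jet_mult (n : nat) :
  forall g k, jet n g -> jet n k -> jet n (fun h => g h * k h)%C.
Proof.
  induction n as [|n IH]; intros g k hg hk.
  - destruct hg as (K & d & hd & H), hk as (K' & d' & hd' & H').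
    exists (K * K'), (Rmin d d'); split; [now apply Rmin_pos|].
    intros h hh. rewrite Cmod_mult.
    apply Rmult_le_compat; try apply Cmod_ge_0; [apply H|apply H'];
      eapply Rlt_le_trans; try exact hh; [apply Rmin_l|apply Rmin_r].
  - pose proof (jet_pred _ _ hk) as hk0.
    destruct hg as (a & g1 & H1 & d & hd & H), hk as (b & k1 & H1' & d' & hd' & H').
    exists (a * b)%C, (fun h => a * k1 h + g1 h * k h)%C; split.
    + apply jet_plus; apply IH; trivial. apply jet_const.
    + exists (Rmin d d'); split; [now apply Rmin_pos|].
      intros h hh.
      rewrite H by (eapply Rlt_le_trans; [exact hh|apply Rmin_l]).
      rewrite H' by (eapply Rlt_le_trans; [exact hh|apply Rmin_r]). ring.
Qed.

Lemma jet_minus (n : nat) (g k : C -> C) :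
  jet n g -> jet n k -> jet n (fun h => g h - k h)%C.
Proof.
  intros hg hk.
  apply jet_ext with (g := fun h => (g h + RtoC (-1) * k h)%C) (d := 1); [lra| |].
  - intros h _. replace (RtoC (-1)) with (- RtoC 1)%C by (rewrite <- RtoC_opp; easy). ring.
  - apply jet_plus; trivial. apply jet_mult; trivial. apply jet_const.
Qed.

Lemma jet1_bound (g : C -> C) : jet 1 g ->
  exists K d : R, 0 <= K /\ 0 < d /\
    forall h, Cmod h < d -> Cmod (g h - g (RtoC 0)) <= K * Cmod h.
Proof.
  intros (a & g1 & (K & d' & hd' & H1) & d & hd & H).
  exists (Rmax 0 K), (Rmin d d'); split; [apply Rmax_l|]; split; [now apply Rmin_pos|].
  intros h hh. rewrite (H (RtoC 0)) by (rewrite Cmod_0; lra).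
  rewrite H by (eapply Rlt_le_trans; [exact hh|apply Rmin_l]).
  replace (a + h * g1 h - (a + RtoC 0 * g1 (RtoC 0)))%C with (h * g1 h)%C by ring.
  rewrite Cmod_mult, Rmult_comm. apply Rmult_le_compat_r; [apply Cmod_ge_0|].
  eapply Rle_trans; [|apply Rmax_r]. apply H1.
  eapply Rlt_le_trans; [exact hh|apply Rmin_r].
Qed.

Lemma jet1_continuous (g : C -> C) (e : R) : jet 1 g -> 0 < e ->
  exists d : R, 0 < d /\
    forall h, Cmod h < d -> Cmod (g h - g (RtoC 0)) < e.
Proof.
  intros hg he. destruct (jet1_bound g hg) as (K & d & hK & hd & H).
  assert (0 < e / (K + 1)) by (apply Rdiv_lt_0_compat; lra).
  exists (Rmin d (e / (K + 1))); split; [now apply Rmin_pos|].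
  intros h hh.
  assert (h1 : Cmod h < d) by (eapply Rlt_le_trans; [exact hh|apply Rmin_l]).
  assert (h2 : Cmod h < e / (K + 1)) by (eapply Rlt_le_trans; [exact hh|apply Rmin_r]).
  pose proof (Cmod_ge_0 h). specialize (H h h1).
  apply Rle_lt_trans with ((K + 1) * Cmod h); [nra|].
  apply Rmult_lt_compat_l with (r := K + 1) in h2; [|lra].
  replace ((K + 1) * (e / (K + 1))) with e in h2 by (field; lra). exact h2.
Qed.

Lemma jet1_neq_0 (g : C -> C) : jet 1 g -> g (RtoC 0) <> RtoC 0 ->
  exists d : R, 0 < d /\
    forall h, Cmod h < d -> Cmod (g (RtoC 0)) / 2 < Cmod (g h) /\ g h <> RtoC 0.
Proof.
  intros hg h0. apply Cmod_gt_0 in h0.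
  destruct (jet1_continuous g (Cmod (g (RtoC 0)) / 2) hg) as (d & hd & H); [lra|].
  exists d; split; [exact hd|]. intros h hh. specialize (H h hh).
  assert (L : Cmod (g (RtoC 0)) / 2 < Cmod (g h)).
  { replace (g (RtoC 0)) with (g h - (g h - g (RtoC 0)))%C by ring.
    pose proof (Cmod_triangle_minus (g h) (g h - g (RtoC 0))).
    replace (g h - (g h - g (RtoC 0)))%C with (g (RtoC 0)) in * by ring. lra. }
  split; [exact L|]. apply Cmod_gt_0. lra.
Qed.

(** From g = a + h g1 follows 1/g = 1/a - h (1/a) g1 (1/g): the tail contains 1/g one order lower,
    whence the induction. The order starts at 1 because mere boundedness of [g] does not keep it
    away from 0, whereas continuity bounds 1/g near 0. *)
Lemma jet_inv (n : nat) :
  forall g, jet (S n) g -> g (RtoC 0) <> RtoC 0 -> jet (S n) (fun h => / g h)%C.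
Proof.
  assert (base : forall g, jet 1 g -> g (RtoC 0) <> RtoC 0 -> jet 0 (fun h => / g h)%C).
  { intros g hg h0. destruct (jet1_neq_0 g hg h0) as (d & hd & H).
    apply Cmod_gt_0 in h0.
    exists (/ (Cmod (g (RtoC 0)) / 2)), d; split; [exact hd|].
    intros h hh. destruct (H h hh) as [H1 H2]. rewrite Cmod_inv by exact H2.
    apply Rinv_le_contravar; lra. }
  assert (step : forall n g, jet (S n) g -> g (RtoC 0) <> RtoC 0 ->
    jet n (fun h => / g h)%C -> jet (S n) (fun h => / g h)%C).
  { intros m g hg h0 hi.
    assert (hg1 : jet 1 g).
    { clear - hg. induction m; [exact hg|]. apply IHm. now apply jet_pred. }
    destruct (jet1_neq_0 g hg1 h0) as (d & hd & H).
    destruct hg as (a & g1 & H1 & d' & hd' & H').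
    assert (ha : g (RtoC 0) = a) by (rewrite H' by (rewrite Cmod_0; lra); ring).
    exists (/ a)%C, (fun h => (RtoC (-1) * / a) * (g1 h * / g h))%C; split.
    - apply jet_mult; [apply jet_const|]. now apply jet_mult.
    - exists (Rmin d d'); split; [now apply Rmin_pos|]. intros h hh.
      assert (hh2 : Cmod h < d') by (eapply Rlt_le_trans; [exact hh|apply Rmin_r]).
      destruct (H h) as [_ N]; [eapply Rlt_le_trans; [exact hh|apply Rmin_l]|].
      rewrite (H' h hh2) in N |- *.
      replace (RtoC (-1)) with (- RtoC 1)%C by (rewrite <- RtoC_opp; easy).
      rewrite ha in h0. field. now split. }
  induction n as [|n IH]; intros g hg h0.
  - apply step; trivial. now apply base.
  - apply step; trivial. apply IH; trivial. now apply jet_pred.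
Qed.

Lemma jet_div (n : nat) (g k : C -> C) :
  jet (S n) g -> jet (S n) k -> k (RtoC 0) <> RtoC 0 ->
  jet (S n) (fun h => g h / k h)%C.
Proof. intros. apply jet_mult; trivial. now apply jet_inv. Qed.

(** * Complex derivatives read off from expansions *)

Lemma C_derive_approx (F : C -> C) (z l : C) (K d : R) :
  0 < d ->
  (forall k, Cmod k < d -> Cmod (F (z + k)%C - F z - k * l)%C <= K * Cmod k ^ 2) ->
  C_derive F z = l.
Proof.
  intros hd H. apply is_C_derive_unique. split.
  - apply is_linear_scal_l.
  - intros x hx. pose proof (@is_filter_lim_locally_unique C_AbsRing (AbsRing_NormedModule C_AbsRing) z x hx) as e. subst x.
    intros eps.
    set (K1 := Rmax 0 K + 1).
    assert (hK : 0 < K1) by (unfold K1; pose proof (Rmax_l 0 K); lra).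
    assert (he : 0 < Rmin d (eps / K1)).
    { apply Rmin_pos; [exact hd|]. apply Rdiv_lt_0_compat; [apply cond_pos|exact hK]. }
    exists (mkposreal _ he). intros y hy.
    change (Cmod (y - z) < Rmin d (eps / K1)) in hy.
    change (Cmod (F y - F z - (y - z) * l) <= eps * Cmod (y - z)).
    specialize (H (y - z)%C).
    replace (z + (y - z))%C with (y : C) in H
      by (assert (E : forall u v : C, v = (u + (v - u))%C) by (intros; ring); apply E).
    eapply Rle_trans; [apply H|].
    + eapply Rlt_le_trans; [exact hy|apply Rmin_l].
    + assert (h2 : Cmod (y - z) < eps / K1)
        by (eapply Rlt_le_trans; [exact hy|apply Rmin_r]).
      apply Rmult_lt_compat_l with (r := K1) in h2; [|lra].
      replace (K1 * (eps / K1)) with (pos eps) in h2 by (field; lra).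
      pose proof (Cmod_ge_0 (y - z)). pose proof (Rmax_r 0 K).
      unfold K1 in *. nra.
Qed.

Lemma C_derive_expansion (F g2 : C -> C) (z a b : C) (d : R) :
  jet 0 g2 -> 0 < d ->
  (forall h, Cmod h < d -> F (z + h)%C = (a + h * (b + h * g2 h))%C) ->
  C_derive F z = b /\
  exists K d : R, 0 <= K /\ 0 < d /\
    forall h, Cmod h < d -> Cmod (F (z + h)%C - F z - h * b)%C <= K * Cmod h ^ 2.
Proof.
  intros (K & d2 & hd2 & H2) hd H.
  assert (B : forall k, Cmod k < Rmin d d2 ->
    Cmod (F (z + k)%C - F z - k * b)%C <= Rmax 0 K * Cmod k ^ 2).
  { intros h hh.
    assert (h1 : Cmod h < d) by (eapply Rlt_le_trans; [exact hh|apply Rmin_l]).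
    assert (h2 : Cmod h < d2) by (eapply Rlt_le_trans; [exact hh|apply Rmin_r]).
    assert (E : F z = a).
    { specialize (H (RtoC 0)). rewrite Cmod_0 in H. specialize (H hd).
      replace (z + RtoC 0)%C with z in H by ring. rewrite H. ring. }
    rewrite (H h h1), E.
    replace (a + h * (b + h * g2 h) - a - h * b)%C with (h * h * g2 h)%C by ring.
    rewrite !Cmod_mult. pose proof (H2 h h2). pose proof (Rmax_r 0 K).
    pose proof (Cmod_ge_0 h). pose proof (Cmod_ge_0 (g2 h)). simpl.
    nra. }
  assert (hp : 0 < Rmin d d2) by (now apply Rmin_pos).
  split; [exact (C_derive_approx F z b _ _ hp B)|].
  exists (Rmax 0 K), (Rmin d d2); split; [apply Rmax_l|now split].
Qed.

(** Order two is required: an expansion of order one is only a Lipschitz estimate at the centre and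
    need not determine a derivative. *)
Lemma jet2_derive (F : C -> C) (z : C) : jet 2 (fun h => F (z + h)%C) ->
  exists K d : R, 0 <= K /\ 0 < d /\
    forall h, Cmod h < d ->
      Cmod (F (z + h)%C - F z - h * C_derive F z)%C <= K * Cmod h ^ 2.
Proof.
  intros (a & g1 & (b & g2 & j & d1 & hd1 & H1) & d & hd & H).
  destruct (C_derive_expansion F g2 z a b (Rmin d d1) j) as [-> B]; [now apply Rmin_pos| |exact B].
  intros h hh.
  rewrite H by (eapply Rlt_le_trans; [exact hh|apply Rmin_l]).
  now rewrite H1 by (eapply Rlt_le_trans; [exact hh|apply Rmin_r]).
Qed.

(** * Power series *)

Notation Cseries := (@is_series C_AbsRing C_NormedModule).
Notation Cpseries := (@is_pseries C_AbsRing C_NormedModule).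

Lemma Cpseries_Cpow (a : nat -> C) (h l : C) :
  Cpseries a h l <-> Cseries (fun n => a n * h ^ n)%C l.
Proof.
  assert (E : forall n, scal (pow_n h n) (a n) = (a n * h ^ n)%C).
  { intro n. rewrite (Cmult_comm (a n)). change (Cmult (pow_n (h : C_AbsRing) n) (a n) = Cmult (Cpow h n) (a n)).
    reflexivity. }
  unfold is_pseries; split; apply is_series_ext; intro n; [|symmetry]; apply E.
Qed.

Lemma Cseries_Cmod_le (u : nat -> C) (b : nat -> R) (l : C) (B : R) :
  Cseries u l -> is_series b B -> (forall n, Cmod (u n) <= b n) -> Cmod l <= B.
Proof.
  intros hu hb H.
  assert (L : is_lim_seq (fun n => Cmod (sum_n u n)) (Cmod l)).
  { exact (filterlim_comp _ _ _ _ _ _ _ _ hu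
      (@filterlim_norm C_AbsRing C_NormedModule l)). }
  refine (is_lim_seq_le _ _ (Cmod l) B _ L hb).
  intro n. eapply Rle_trans.
  - exact (@norm_sum_n_m C_AbsRing C_NormedModule u 0 n).
  - apply sum_n_m_le. intro k. apply H.
Qed.

Lemma Cseries_bounded_terms (u : nat -> C) (l : C) :
  Cseries u l -> exists M, 0 < M /\ forall n, Cmod (u n) <= M.
Proof.
  intro hu.
  assert (L : is_lim_seq (fun n => Cmod (sum_n u n)) (Cmod l)).
  { exact (filterlim_comp _ _ _ _ _ _ _ _ hu
      (@filterlim_norm C_AbsRing C_NormedModule l)). }
  apply is_lim_seq_Reals in L.
  destruct (maj_by_pos _ (exist _ _ L)) as (M & hM & H).
  assert (H' : forall n, Cmod (sum_n u n) <= M).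
  { intro n. eapply Rle_trans; [apply Rle_abs|apply H]. }
  exists (M + M); split; [lra|]. intros [|n].
  - specialize (H' O). rewrite sum_O in H'. lra.
  - replace (u (S n)) with (sum_n u (S n) - sum_n u n)%C.
    + eapply Rle_trans; [apply Cmod_triangle_minus|].
      pose proof (H' n). pose proof (H' (S n)). lra.
    + rewrite sum_Sn. change (sum_n u n + u (S n) - sum_n u n = u (S n))%C. ring.
Qed.

Lemma Cseries_unique (u : nat -> C) (l l' : C) :
  Cseries u l -> Cseries u l' -> l = l'.
Proof. intros h h'. exact (filterlim_locally_unique _ _ _ h h'). Qed.

(** A Cauchy estimate without integrals: convergence at the real point s < r already bounds the
    terms of the series there. *)
Lemma pseries_coef_bound (a : nat -> C) (F : C -> C) (r : R) :
  (forall h, Cmod h < r -> Cpseries a h (F h)) ->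
  forall s, 0 <= s < r -> exists M, 0 < M /\ forall n, Cmod (a n) * s ^ n <= M.
Proof.
  intros H s hs.
  assert (E : Cmod (RtoC s) = s) by (rewrite Cmod_R; apply Rabs_pos_eq; lra).
  specialize (H (RtoC s)). rewrite E in H. specialize (H (proj2 hs)).
  apply Cpseries_Cpow in H.
  destruct (Cseries_bounded_terms _ _ H) as (M & hM & B).
  exists M; split; [exact hM|]. intro n. specialize (B n).
  now rewrite Cmod_mult, Cmod_pow, E in B.
Qed.

(** Shifting the coefficients turns a power series into its Horner tail, so in the end only
    boundedness of a sum is left. On |h| < r / 4 the coefficient bound at radius r / 2 leaves a
    geometric series of ratio 1 / 2. *)
Lemma pseries_jet (n : nat) : forall (a : nat -> C) (F : C -> C) (r : R),
  0 < r -> (forall h, Cmod h < r -> Cpseries a h (F h)) -> jet n F.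
Proof.
  induction n as [|n IH]; intros a F r hr H.
  - destruct (pseries_coef_bound a F r H (r / 2)) as (M & hM & B); [lra|].
    exists (M * / (1 - 1 / 2)), (r / 4); split; [lra|]. intros h hh.
    assert (hs := H h ltac:(lra)). apply Cpseries_Cpow in hs.
    refine (Cseries_Cmod_le _ (fun k => M * (1 / 2) ^ k) _ _ hs _ _).
    + apply (is_series_scal_l M (fun k => (1 / 2) ^ k) (/ (1 - 1 / 2))).
      apply is_series_geom. rewrite Rabs_pos_eq; lra.
    + intro k. rewrite Cmod_mult, Cmod_pow.
      apply Rle_trans with (Cmod (a k) * (r / 2) ^ k * (1 / 2) ^ k).
      * rewrite Rmult_assoc, <- Rpow_mult_distr. apply Rmult_le_compat_l; [apply Cmod_ge_0|].
        apply pow_incr. split; [apply Cmod_ge_0|lra].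
      * apply Rmult_le_compat_r; [apply pow_le; lra|apply B].
  - set (F1 := fun h => if Ceq_dec h (RtoC 0) then a 1%nat else (/ h * (F h - a O))%C).
    exists (a O), F1. split.
    + apply (IH (fun k => a (S k)) F1 r hr). intros h hh. unfold F1.
      destruct (Ceq_dec h (RtoC 0)) as [e|ne].
      * subst h. change (fun k => a (S k)) with (PS_decr_1 a).
        pose proof (@is_pseries_0 C_AbsRing C_NormedModule (PS_decr_1 a)) as P. exact P.
      * exact (@is_pseries_decr_1 C_AbsRing C_NormedModule a h (/ h)%C (F h)
          (Cinv_l h ne) (H h hh)).
    + exists r; split; [exact hr|]. intros h hh. unfold F1.
      destruct (Ceq_dec h (RtoC 0)) as [e|ne].
      * subst h. pose proof (@is_pseries_0 C_AbsRing C_NormedModule a) as P.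
        rewrite (Cseries_unique _ _ _ (H _ hh) P). ring.
      * field. exact ne.
Qed.

Lemma analytic_jet (n : nat) (f : C -> C) (z : C) :
  analytic_at f z -> jet n (fun h => f (z + h)%C).
Proof.
  intros (a & r & hr & H). apply (pseries_jet n a _ r hr). intros h hh.
  specialize (H (z + h)%C). replace (z + h - z)%C with h in H by ring. now apply H.
Qed.

(** Absorbs the factor n^2 of the power remainders: against coefficients decaying like (1/2)^n it
    leaves the summable (3/4)^n. *)
Lemma sqr_le_geom (n : nat) : INR n ^ 2 <= 4 * (3 / 2) ^ n.
Proof.
  (* The induction step is (n + 1)^2 <= (3/2) n^2, which holds from n = 5 on and fails at n = 4. *)
  destruct (Nat.le_gt_cases 5 n) as [hn|hn].
  - induction hn as [|n hn IH]; [simpl; lra|].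
    apply le_INR in hn. rewrite S_INR. simpl in *. nra.
  - do 5 (destruct n as [|n]; [simpl; lra|]). lia.
Qed.

(* The recursion is E_{n+1} = (h+k) E_n + n k^2 h^(n-1) for the remainder E_n. *)
Lemma Cpow_remainder (h k : C) (s : R) (n : nat) :
  Cmod h <= s -> Cmod (h + k) <= s ->
  s ^ 2 * Cmod ((h + k) ^ n - h ^ n - k * (INR n * h ^ pred n))
    <= INR n ^ 2 * Cmod k ^ 2 * s ^ n.
Proof.
  intros hh hk.
  assert (hs : 0 <= s) by (pose proof (Cmod_ge_0 h); lra).
  assert (D : forall m, (INR (S m) * h ^ pred (S m))%C = (RtoC (INR m) * h ^ m + h ^ m)%C).
  { intro m. rewrite S_INR, RtoC_plus. simpl. ring. }
  (* The factor [s ^ 2] in the claim clears the exponent n - 2 of the usual bound, so that s = 0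
     needs no separate treatment. *)
  assert (Q : forall m, s ^ 2 * (Cmod (RtoC (INR m) * h ^ pred m)) <= INR m * s ^ S m).
  { intro m. rewrite Cmod_mult, Cmod_pow, Cmod_R, Rabs_pos_eq by apply pos_INR.
    destruct m as [|m]; [simpl; lra|]. simpl pred.
    pose proof (pos_INR (S m)).
    replace (s ^ 2 * (INR (S m) * Cmod h ^ m)) with (INR (S m) * s ^ 2 * Cmod h ^ m) by ring.
    replace (INR (S m) * s ^ S (S m)) with (INR (S m) * s ^ 2 * s ^ m) by (simpl; ring).
    apply Rmult_le_compat_l; [|apply pow_incr; split; [apply Cmod_ge_0|exact hh]].
    pose proof (pow_le s 2 hs). nra. }
  induction n as [|n IH].
  - simpl. replace (RtoC 1 - RtoC 1 - k * (RtoC 0 * RtoC 1))%C with (RtoC 0) by ring.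
    rewrite Cmod_0. lra.
  - rewrite D.
    replace ((h + k) ^ S n - h ^ S n - k * (RtoC (INR n) * h ^ n + h ^ n))%C
      with ((h + k) * ((h + k) ^ n - h ^ n - k * (RtoC (INR n) * h ^ pred n))
            + k * k * (RtoC (INR n) * h ^ pred n))%C.
    2:{ destruct n as [|n]; simpl; ring. }
    apply Rle_trans with (s * (s ^ 2 * Cmod ((h + k) ^ n - h ^ n - k * (RtoC (INR n) * h ^ pred n)))
      + Cmod k ^ 2 * (s ^ 2 * Cmod (RtoC (INR n) * h ^ pred n))).
    + replace (s * (s ^ 2 * Cmod ((h + k) ^ n - h ^ n - k * (RtoC (INR n) * h ^ pred n)))
      + Cmod k ^ 2 * (s ^ 2 * Cmod (RtoC (INR n) * h ^ pred n))) with
        (s ^ 2 * (s * Cmod ((h + k) ^ n - h ^ n - k * (RtoC (INR n) * h ^ pred n))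
         + Cmod k ^ 2 * Cmod (RtoC (INR n) * h ^ pred n))) by ring.
      apply Rmult_le_compat_l; [apply pow_le, hs|].
      eapply Rle_trans; [apply Cmod_triangle|].
      rewrite !(Cmod_mult (h + k)), !(Cmod_mult (k * k)), (Cmod_mult k k).
      apply Rplus_le_compat; [apply Rmult_le_compat_r; [apply Cmod_ge_0|exact hk]|].
      right. simpl. ring.
    + pose proof (Rmult_le_compat_l s _ _ hs IH) as I1.
      pose proof (Rmult_le_compat_l _ _ _ (pow2_ge_0 (Cmod k)) (Q n)) as I2.
      eapply Rle_trans; [apply Rplus_le_compat; [exact I1|exact I2]|].
      rewrite S_INR.
      replace (s * (INR n ^ 2 * Cmod k ^ 2 * s ^ n) + Cmod k ^ 2 * (INR n * s ^ S n))
        with ((INR n ^ 2 + INR n) * (Cmod k ^ 2 * s ^ S n)) by (simpl; ring).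
      replace ((INR n + 1) ^ 2 * Cmod k ^ 2 * s ^ S n)
        with ((INR n + 1) ^ 2 * (Cmod k ^ 2 * s ^ S n)) by ring.
      apply Rmult_le_compat_r.
      * apply Rmult_le_pos; [apply pow2_ge_0|apply pow_le, hs].
      * pose proof (pos_INR n). nra.
Qed.

(** Termwise differentiation. The series of derivatives is centred at [z], while [C_derive f] has to
    be identified at every nearby point y = z + h; this is done by summing [Cpow_remainder] over n.
    The radius shrinks to r / 4 to make the bounds geometric. *)
Lemma analytic_derive (f : C -> C) (z : C) :
  analytic_at f z -> analytic_at (C_derive f) z.
Proof.
  intros (a & r & hr & H).
  assert (H' : forall h, Cmod h < r -> Cpseries a h (f (z + h)%C)).
  { intros h hh. specialize (H (z + h)%C).
    replace (z + h - z)%C with h in H by ring. now apply H. }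
  destruct (pseries_coef_bound a _ r H' (r / 2)) as (M & hM & B); [lra|].
  set (s := r / 4).
  assert (hs : 0 < s) by (unfold s; lra).
  assert (As : forall n, Cmod (a n) * s ^ n <= M * (1 / 2) ^ n).
  { intro n. replace s with (r / 2 * (1 / 2)) by (unfold s; field).
    rewrite Rpow_mult_distr, <- Rmult_assoc.
    apply Rmult_le_compat_r; [apply pow_le; lra|apply B]. }
  assert (Bn : forall n, Cmod (a n) * (INR n ^ 2 * s ^ n) <= 4 * M * (3 / 4) ^ n).
  { intro n. replace (3 / 4) with (3 / 2 * (1 / 2)) by field. rewrite Rpow_mult_distr.
    pose proof (sqr_le_geom n). specialize (As n).
    replace (Cmod (a n) * (INR n ^ 2 * s ^ n)) with (INR n ^ 2 * (Cmod (a n) * s ^ n)) by ring.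
    replace (4 * M * ((3 / 2) ^ n * (1 / 2) ^ n))
      with (4 * (3 / 2) ^ n * (M * (1 / 2) ^ n)) by ring.
    apply Rmult_le_compat; trivial; [apply pow2_ge_0|].
    apply Rmult_le_pos; [apply Cmod_ge_0|apply pow_le; lra]. }
  assert (geo : is_series (fun n => 4 * M * (3 / 4) ^ n) (4 * M * / (1 - 3 / 4))).
  { apply (is_series_scal_l (4 * M) (fun k => (3 / 4) ^ k) (/ (1 - 3 / 4))).
    apply is_series_geom. rewrite Rabs_pos_eq; lra. }
  exists (fun n => RtoC (INR (S n)) * a (S n))%C, s; split; [exact hs|].
  intros y hy. set (h := (y - z)%C) in *.
  assert (ey : y = (z + h)%C) by (unfold h; ring).
  set (u := fun n => (a n * (RtoC (INR n) * h ^ pred n))%C).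
  assert (ex : @ex_series C_AbsRing C_NormedModule u).
  { apply (@ex_series_le C_AbsRing C_CompleteNormedModule u (fun n => / s * (4 * M * (3 / 4) ^ n))).
    - intro n. change (Cmod (u n) <= / s * (4 * M * (3 / 4) ^ n)).
      eapply Rle_trans; [|apply Rmult_le_compat_l; [left; now apply Rinv_0_lt_compat|apply Bn]].
      unfold u. rewrite !Cmod_mult, Cmod_pow, Cmod_R, Rabs_pos_eq by apply pos_INR.
      destruct n as [|n]; [simpl; right; ring|]. simpl pred.
      replace (/ s * (Cmod (a (S n)) * (INR (S n) ^ 2 * s ^ S n)))
        with (Cmod (a (S n)) * (INR (S n) ^ 2 * s ^ n)) by (simpl; field; lra).
      apply Rmult_le_compat_l; [apply Cmod_ge_0|].
      apply Rmult_le_compat; [apply pos_INR|apply pow_le, Cmod_ge_0| |].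
      + rewrite S_INR. pose proof (pos_INR n). nra.
      + apply pow_incr. split; [apply Cmod_ge_0|lra].
    - exists (/ s * (4 * M * / (1 - 3 / 4))). apply (is_series_scal_l (/ s) _ _ geo). }
  destruct ex as [l hl].
  (* The quadratic error constant is the sum of the bounds [Bn] divided by s^2; the radius s - |h|
     keeps z + h + k in the disk where they apply. *)
  assert (dl : C_derive f y = l).
  { apply (C_derive_approx f y l (/ s ^ 2 * (4 * M * / (1 - 3 / 4))) (s - Cmod h)); [lra|].
    intros k hk.
    assert (hhk : Cmod (h + k) < s) by (pose proof (Cmod_triangle h k); lra).
    assert (S1 := H' h ltac:(unfold s in *; lra)). apply Cpseries_Cpow in S1.
    assert (S2 := H' (h + k)%C ltac:(unfold s in *; lra)). apply Cpseries_Cpow in S2.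
    rewrite Cplus_assoc in S2. rewrite <- ey in S1, S2.
    assert (S3 := @is_series_scal_l C_AbsRing C_NormedModule k _ _ hl).
    assert (S4 := @is_series_minus C_AbsRing C_NormedModule _ _ _ _ S2 S1).
    assert (S5 := @is_series_minus C_AbsRing C_NormedModule _ _ _ _ S4 S3).
    change (Cseries (fun n => a n * (h + k) ^ n + - (a n * h ^ n) + - (k * u n))%C
      (f (y + k)%C - f y - k * l)%C) in S5.
    replace (/ s ^ 2 * (4 * M * / (1 - 3 / 4)) * Cmod k ^ 2)
      with (/ s ^ 2 * Cmod k ^ 2 * (4 * M * / (1 - 3 / 4))) by ring.
    refine (Cseries_Cmod_le _ _ _ _ S5
      (is_series_scal_l (/ s ^ 2 * Cmod k ^ 2) _ _ geo) _).
    intro n. unfold u.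
    replace (a n * (h + k) ^ n + - (a n * h ^ n) + - (k * (a n * (RtoC (INR n) * h ^ pred n))))%C
      with (a n * ((h + k) ^ n - h ^ n - k * (RtoC (INR n) * h ^ pred n)))%C by ring.
    change (scal (/ s ^ 2 * Cmod k ^ 2) (4 * M * (3 / 4) ^ n)) with
      (/ s ^ 2 * Cmod k ^ 2 * (4 * M * (3 / 4) ^ n)).
    rewrite Cmod_mult.
    assert (s2 : 0 < s ^ 2) by now apply pow_lt.
    apply Rmult_le_reg_l with (s ^ 2); [exact s2|].
    replace (s ^ 2 * (/ s ^ 2 * Cmod k ^ 2 * (4 * M * (3 / 4) ^ n)))
      with (Cmod k ^ 2 * (4 * M * (3 / 4) ^ n)) by (field; lra).
    pose proof (Cpow_remainder h k s n ltac:(lra) ltac:(lra)) as R.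
    apply Rmult_le_compat_l with (r := Cmod (a n)) in R; [|apply Cmod_ge_0].
    pose proof (Rmult_le_compat_l _ _ _ (pow2_ge_0 (Cmod k)) (Bn n)). nra. }
  rewrite dl. apply Cpseries_Cpow.
  apply (is_series_ext (fun k => u (S k))).
  - intro n. unfold u. simpl pred.
    match goal with |- ?x = ?y => change (@eq C x y) end. ring.
  (* The index shift loses nothing: the term [u O] carries the factor n = 0. *)
  - apply (is_series_incr_1 u).
    replace (plus l (u O)) with l; [exact hl|].
    assert (Z : forall x y w : C, x = (x + y * (RtoC 0 * w))%C) by (intros; ring).
    exact (Z l (a O) (h ^ pred 0)%C).
Qed.

(** * Maximum modulus *)

Lemma Cmod_le_abs_sum (z : C) : Cmod z <= Rabs (Re z) + Rabs (Im z).
Proof.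
  destruct z as [x y]. unfold Cmod; simpl.
  pose proof (Rabs_pos x). pose proof (Rabs_pos y).
  apply Rsqr_incr_0_var; [|lra].
  rewrite Rsqr_sqrt by nra.
  assert (x ^ 2 = Rabs x ^ 2) by now rewrite pow2_abs.
  assert (y ^ 2 = Rabs y ^ 2) by now rewrite pow2_abs.
  unfold Rsqr. simpl in *. nra.
Qed.

Lemma im_le_Cmod (z : C) : Rabs (Im z) <= Cmod z.
Proof. eapply Rle_trans; [apply Rmax_r|apply (Rmax_Cmod z)]. Qed.

Lemma list_argmax {T : Type} (F : T -> R) (l : list T) (t : T) :
  In t l -> exists m, In m l /\ forall x, In x l -> F x <= F m.
Proof.
  intro ht. assert (hn : l <> nil) by (intros ->; exact ht). clear t ht.
  induction l as [|a l IH]; [now elim hn|]. destruct l as [|b l].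
  - exists a; split; [now left|]. intros x [<-|[]]; lra.
  - destruct IH as (m & hm & H); [discriminate|].
    destruct (Rle_dec (F a) (F m)) as [h|h].
    + exists m; split; [now right|]. intros x [<-|hx]; [exact h|now apply H].
    + exists a; split; [now left|]. intros x [<-|hx]; [lra|]. specialize (H x hx). lra.
Qed.

(* If no maximum is attained, finitely many neighbourhoods on which F stays
   below some value F y, with y in K, cover K. *)
Lemma usc_attains_max (K : C -> Prop) (F : C -> R) (B : R) :
  (forall z, K z -> Cmod z <= B) ->
  (forall z, ~ K z -> exists d, 0 < d /\ forall y, Cmod (y - z) < d -> ~ K y) ->
  (forall z c, K z -> F z < c ->
     exists d, 0 < d /\ forall y, K y -> Cmod (y - z) < d -> F y < c) ->
  (exists z, K z) ->
  exists z, K z /\ forall y, K y -> F y <= F z.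
Proof.
  intros hB hcl husc [k0 hk0]. apply NNPP. intro N.
  assert (N' : forall z, K z -> exists y, K y /\ F z < F y).
  { intros z hz. apply NNPP. intro M. apply N. exists z; split; [exact hz|].
    intros y hy. apply Rnot_lt_le. intro L. apply M. now exists y. }
  assert (loc : forall t : C, exists p : posreal * C, K (snd p) /\
    forall x, K x -> Cmod (x - t) < fst p -> F x < F (snd p)).
  { intro t. destruct (classic (K t)) as [ht|ht].
    - destruct (N' t ht) as (y & hy & hty).
      destruct (husc t (F y) ht hty) as (d & hd & H).
      now exists (mkposreal d hd, y).
    - destruct (hcl t ht) as (d & hd & H).
      exists (mkposreal d hd, k0). split; [exact hk0|].
      intros x hx hxt. now elim (H x hxt). }
  set (c := fun t => proj1_sig (constructive_indefinite_description _ (loc t))).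
  assert (hc : forall t, K (snd (c t)) /\
    forall x, K x -> Cmod (x - t) < fst (c t) -> F x < F (snd (c t))).
  { intro t. exact (proj2_sig (constructive_indefinite_description _ (loc t))). }
  set (pt := fun u : Compactness.Tn 2 R => (fst u, fst (snd u)) : C).
  (* The finite cover comes under a double negation, which the goal [False] absorbs. Radii are
     halved because closeness is coordinatewise and |x - t| is at most the sum of the two coordinate
     distances. *)
  apply (compactness_list 2 (- B, (- B, tt)) (B, (B, tt))
    (fun u => pos_div_2 (fst (c (pt u))))).
  intros (l & hl).
  assert (cov : forall x, K x -> exists u, In u l /\ F x < F (snd (c (pt u)))).
  { intros x hx. destruct (hl (fst x, (snd x, tt))) as ([u1 [u2 []]] & hu & _ & hclose).
    - pose proof (hB x hx). pose proof (re_le_Cmod x). pose proof (im_le_Cmod x).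
      unfold Re, Im in *. simpl.
      split; [|split; [|exact I]]; apply Rabs_le_between; lra.
    - eexists; split; [exact hu|]. apply hc; [exact hx|].
      destruct hclose as (h1 & h2 & _).
      change (Cmod (x - (u1, u2)) < fst (c (u1, u2))).
      change (Rabs (fst x - u1) < fst (c (u1, u2)) / 2) in h1.
      change (Rabs (snd x - u2) < fst (c (u1, u2)) / 2) in h2.
      eapply Rle_lt_trans; [apply Cmod_le_abs_sum|].
      change (Rabs (fst x - u1) + Rabs (snd x - u2) < fst (c (u1, u2))). lra. }
  destruct (cov k0 hk0) as (u0 & hu0 & _).
  (* The point carrying the largest of the finitely many chosen values lies in [K], so it is covered
     too and must lie strictly below one of these values. *)
  destruct (list_argmax (fun u => F (snd (c (pt u)))) l u0 hu0) as (m & hm & H).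
  destruct (cov (snd (c (pt m))) (proj1 (hc (pt m)))) as (u & hu & L).
  specialize (H u hu). simpl in H. lra.
Qed.

Lemma Cmod_sqr (z : C) : Cmod z ^ 2 = fst z ^ 2 + snd z ^ 2.
Proof. exact (Cmod2_alt z). Qed.

(** This is |x + y| >= |x| - |y| squared, with the error kept linear in |y|. The right side of that
    inequality can be negative, hence the case distinction. *)
Lemma Cmod_sqr_plus_ge (x y : C) (M : R) : Cmod x <= M ->
  Cmod x ^ 2 - 2 * M * Cmod y <= Cmod (x + y) ^ 2.
Proof.
  intro hx. pose proof (Cmod_triangle_minus (x + y) y) as T.
  replace (x + y - y)%C with x in T by ring.
  pose proof (Cmod_ge_0 x). pose proof (Cmod_ge_0 y). pose proof (Cmod_ge_0 (x + y)).
  destruct (Rle_dec (Cmod x) (Cmod y)); nra.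
Qed.

(* Averaging over h = s, -s, is, -is kills the linear and quadratic terms of
   g, so the mean of |g h|^2 is at least |g 0|^2 - O(s^3). *)
Lemma jet3_no_local_max (g : C -> C) (z : C) (e d : R) :
  jet 3 g -> 0 < e -> 0 < d ->
  exists h, Cmod h < d /\
    Cmod (g (RtoC 0)) ^ 2 + e * Cmod z ^ 2 < Cmod (g h) ^ 2 + e * Cmod (z + h) ^ 2.
Proof.
  intros (a & g1 & (b & g2 & (c & g3 & (K & d0 & hd0 & H0) & d3 & hd3 & H3)
    & d2 & hd2 & H2) & d1 & hd1 & H1) he hd.
  set (M := Cmod a + Cmod b + Cmod c).
  set (K1 := Rmax 0 K).
  assert (hK1 : 0 <= K1) by apply Rmax_l.
  assert (hM : 0 <= M).
  { unfold M. pose proof (Cmod_ge_0 a). pose proof (Cmod_ge_0 b). pose proof (Cmod_ge_0 c). lra. }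
  assert (MK : 0 <= M * K1) by now apply Rmult_le_pos.
  assert (es : 0 < e / (2 * (M * K1) + 1)) by (apply Rdiv_lt_0_compat; lra).
  set (m := Rmin 1 (Rmin d (Rmin d0 (Rmin d1 (Rmin d2 (Rmin d3 (e / (2 * (M * K1) + 1)))))))).
  assert (hm : 0 < m) by (unfold m; repeat apply Rmin_pos; trivial; lra).
  assert (ms : m <= 1 /\ m <= d /\ m <= d0 /\ m <= d1 /\ m <= d2 /\ m <= d3
    /\ m <= e / (2 * (M * K1) + 1)).
  { unfold m. repeat split; repeat (first [apply Rle_refl | apply Rmin_l |
      (eapply Rle_trans; [apply Rmin_r|])]). }
  destruct ms as (m1 & m2 & m3 & m4 & m5 & m6 & m7).
  set (s := m / 2). assert (hs : 0 < s) by (unfold s; lra).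
  assert (hse : 2 * (M * K1) * s < e).
  { apply Rmult_le_compat_l with (r := 2 * (M * K1) + 1) in m7; [|lra].
    replace ((2 * (M * K1) + 1) * (e / (2 * (M * K1) + 1))) with e in m7 by (field; lra).
    unfold s. nra. }
  set (T := fun h => (a + h * b + h * h * c)%C).
  assert (low : forall h, Cmod h = s ->
    Cmod (T h) ^ 2 - 2 * M * (K1 * s ^ 3) <= Cmod (g h) ^ 2).
  { intros h hh.
    assert (E : g h = (T h + h * h * h * g3 h)%C).
    { rewrite H1, H2, H3 by (unfold s in *; lra). unfold T. ring. }
    rewrite E. eapply Rle_trans; [|apply Cmod_sqr_plus_ge with (M := M)].
    - apply Rplus_le_compat_l, Ropp_le_contravar, Rmult_le_compat_l; [lra|].
      rewrite !Cmod_mult, hh.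
      replace (K1 * s ^ 3) with (s * s * s * K1) by ring.
      apply Rmult_le_compat_l.
      { replace (s * s * s) with (s ^ 3) by ring. now apply pow_le, Rlt_le. }
      eapply Rle_trans; [|apply Rmax_r]. apply H0. unfold s in *; lra.
    - unfold T, M. eapply Rle_trans; [apply Cmod_triangle|].
      eapply Rle_trans; [apply Rplus_le_compat_r, Cmod_triangle|].
      rewrite !Cmod_mult, hh. pose proof (Cmod_ge_0 b). pose proof (Cmod_ge_0 c).
      assert (s1 : s <= 1) by (unfold s; lra). clearbody s.
      assert (s * Cmod b <= Cmod b) by nra.
      assert (s * s <= 1) by nra.
      assert (s * s * Cmod c <= Cmod c) by nra. lra. }
  assert (g0 : g (RtoC 0) = a) by (rewrite H1 by (rewrite Cmod_0; lra); ring).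
  assert (c1 : Cmod (s, 0) = s).
  { unfold Cmod; simpl. replace (s * (s * 1) + 0 * (0 * 1)) with (s * s) by ring.
    apply sqrt_square; lra. }
  assert (c2 : Cmod (- s, 0) = s).
  { unfold Cmod; simpl. replace (- s * (- s * 1) + 0 * (0 * 1)) with (s * s) by ring.
    apply sqrt_square; lra. }
  assert (c3 : Cmod (0, s) = s).
  { unfold Cmod; simpl. replace (0 * (0 * 1) + s * (s * 1)) with (s * s) by ring.
    apply sqrt_square; lra. }
  assert (c4 : Cmod (0, - s) = s).
  { unfold Cmod; simpl. replace (0 * (0 * 1) + - s * (- s * 1)) with (s * s) by ring.
    apply sqrt_square; lra. }
  assert (avg : 4 * Cmod a ^ 2 <= Cmod (T (s, 0)) ^ 2 + Cmod (T (- s, 0)) ^ 2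
     + Cmod (T (0, s)) ^ 2 + Cmod (T (0, - s)) ^ 2).
  { rewrite !Cmod_sqr. unfold T. destruct a as [a1 a2], b as [b1 b2], c as [e1 e2]. simpl.
    pose proof (pow2_ge_0 (s * b1)). pose proof (pow2_ge_0 (s * b2)).
    pose proof (pow2_ge_0 (s * s * e1)). pose proof (pow2_ge_0 (s * s * e2)).
    nra. }
  (* The term e |z|^2 gains e s^2 per point on average; [cub] says that this exceeds the cubic loss
     in [low]. *)
  assert (avz : 4 * Cmod z ^ 2 + 4 * s ^ 2 = Cmod (z + (s, 0)) ^ 2 + Cmod (z + (- s, 0)) ^ 2
     + Cmod (z + (0, s)) ^ 2 + Cmod (z + (0, - s)) ^ 2).
  { rewrite !Cmod_sqr. destruct z as [z1 z2]. simpl. ring. }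
  assert (cub : 2 * M * (K1 * s ^ 3) < e * s ^ 2).
  { replace (2 * M * (K1 * s ^ 3)) with (2 * (M * K1) * s * s ^ 2) by ring.
    apply Rmult_lt_compat_r; [now apply pow_lt|exact hse]. }
  assert (hsd : s < d) by (unfold s; lra).
  apply NNPP. intro N.
  assert (N' : forall h, Cmod h = s ->
    Cmod (g h) ^ 2 + e * Cmod (z + h) ^ 2 <= Cmod a ^ 2 + e * Cmod z ^ 2).
  { intros h hh. apply Rnot_lt_le. intro L. apply N. exists h. rewrite g0.
    split; [lra|exact L]. }
  pose proof (low _ c1). pose proof (low _ c2). pose proof (low _ c3). pose proof (low _ c4).
  pose proof (N' _ c1). pose proof (N' _ c2). pose proof (N' _ c3). pose proof (N' _ c4).
  apply (f_equal (Rmult e)) in avz. lra.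
Qed.

(** Adding e |z|^2 to |g|^2 makes the function strictly subharmonic, so [jet3_no_local_max] excludes
    an interior maximum, and a small [e] excludes one on the circle. *)
Lemma max_modulus (g : C -> C) (r B : R) :
  0 < r ->
  (forall z, Cmod z <= r -> jet 3 (fun h => g (z + h)%C)) ->
  (forall z, Cmod z = r -> Cmod (g z) <= B) ->
  forall z, Cmod z <= r -> Cmod (g z) <= B.
Proof.
  intros hr hg hB z hz. apply Rnot_lt_le. intro L.
  assert (B0 : 0 <= B).
  { eapply Rle_trans; [apply Cmod_ge_0|apply (hB (RtoC r))].
    rewrite Cmod_R. apply Rabs_pos_eq; lra. }
  assert (hr2 : 0 < r ^ 2) by now apply pow_lt.
  assert (L2 : B ^ 2 < Cmod (g z) ^ 2) by nra.
  (* With this choice e r^2 is half the excess of |g z|^2 over B^2, so every value on the circle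
     stays below the value at [z]. *)
  set (e := (Cmod (g z) ^ 2 - B ^ 2) / (2 * r ^ 2)).
  assert (he : 0 < e) by (apply Rdiv_lt_0_compat; lra).
  assert (her : e * r ^ 2 < Cmod (g z) ^ 2 - B ^ 2).
  { unfold e. replace ((Cmod (g z) ^ 2 - B ^ 2) / (2 * r ^ 2) * r ^ 2)
      with ((Cmod (g z) ^ 2 - B ^ 2) / 2) by (field; lra). lra. }
  destruct (usc_attains_max (fun z => Cmod z <= r)
    (fun z => Cmod (g z) ^ 2 + e * Cmod z ^ 2) r) as (x & hx & H).
  - trivial.
  - intros y hy. apply Rnot_le_lt in hy. exists (Cmod y - r); split; [lra|].
    intros u hu. pose proof (Cmod_triangle_minus u (u - y)) as T.
    replace (u - (u - y))%C with y in T by ring. lra.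
  - intros y c hy hc. specialize (hg y hy).
    assert (j1 : jet 1 (fun h => g (y + h)%C)) by (now do 2 apply jet_pred).
    set (s := c - (Cmod (g y) ^ 2 + e * Cmod y ^ 2)).
    assert (hs : 0 < s) by (unfold s; lra).
    (* [A] is a Lipschitz constant from above: moving [u] and [g u] by less than n <= 1 raises the
       function by less than A n. *)
    set (A := 2 * Cmod (g y) + 1 + e * (2 * Cmod y + 1)).
    pose proof (Cmod_ge_0 (g y)) as p1. pose proof (Cmod_ge_0 y) as p2.
    assert (hA : 0 < A) by (unfold A; nra).
    assert (hsA : 0 < s / A) by now apply Rdiv_lt_0_compat.
    set (n := Rmin 1 (s / A)).
    assert (hn : 0 < n) by (apply Rmin_pos; lra).
    destruct (jet1_continuous _ n j1 hn) as (d & hd & HD).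
    exists (Rmin n d); split; [now apply Rmin_pos|]. intros u _ hu.
    assert (hu1 : Cmod (u - y) < n) by (eapply Rlt_le_trans; [exact hu|apply Rmin_l]).
    specialize (HD (u - y)%C).
    replace (y + (u - y))%C with u in HD by ring.
    replace (y + RtoC 0)%C with y in HD by ring.
    assert (hu2 : Cmod (g u - g y) < n)
      by (apply HD; eapply Rlt_le_trans; [exact hu|apply Rmin_r]).
    assert (q1 : Cmod u < Cmod y + n).
    { replace u with (y + (u - y))%C by ring. pose proof (Cmod_triangle y (u - y)). lra. }
    assert (q2 : Cmod (g u) < Cmod (g y) + n).
    { replace (g u) with (g y + (g u - g y))%C by ring.
      pose proof (Cmod_triangle (g y) (g u - g y)). lra. }
    assert (n1 : n <= 1) by apply Rmin_l.
    assert (n2 : A * n <= s).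
    { assert (n2 : n <= s / A) by apply Rmin_r.
      apply Rmult_le_compat_l with (r := A) in n2; [|lra].
      now replace (A * (s / A)) with s in n2 by (field; lra). }
    pose proof (Cmod_ge_0 u). pose proof (Cmod_ge_0 (g u)).
    assert (Cmod (g u) ^ 2 < Cmod (g y) ^ 2 + (2 * Cmod (g y) + 1) * n) by nra.
    assert (Cmod u ^ 2 < Cmod y ^ 2 + (2 * Cmod y + 1) * n) by nra.
    unfold A, s in n2. nra.
  - now exists z.
  - pose proof (H z hz) as Hz. simpl in Hz.
    assert (hxr : Cmod x < r).
    { destruct (Rle_lt_or_eq_dec _ _ hx) as [l|E]; [exact l|].
      pose proof (hB x E). pose proof (Cmod_ge_0 (g x)). pose proof (Cmod_ge_0 z).
      rewrite E in Hz. nra. }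
    destruct (jet3_no_local_max _ x e (r - Cmod x) (hg x hx) he) as (h & hh & N); [lra|].
    replace (x + RtoC 0)%C with x in N by ring.
    specialize (H (x + h)%C). simpl in H, N.
    pose proof (Cmod_triangle x h). lra.
Qed.

(** * The first point where Re p <= alpha *)

(** Here the singularity at 0 is removed once and for all. [qd] plays the part of q' but is defined
    by f' = q + z q', so that its expansions come from those of f and f'. *)
Lemma class_A_quotient (f : C -> C) : class_A f ->
  exists q qd : C -> C, q (RtoC 0) = RtoC 1 /\
    forall z, unit_disk z ->
      jet 3 (fun h => q (z + h)%C) /\ jet 3 (fun h => qd (z + h)%C) /\
      f z = (z * q z)%C /\ C_derive f z = (q z + z * qd z)%C.
Proof.
  intros (an & f0 & df0).
  assert (jf : forall n z, unit_disk z -> jet n (fun h => f (z + h)%C))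
    by (intros; apply analytic_jet; auto).
  assert (jd : forall n z, unit_disk z -> jet n (fun h => C_derive f (z + h)%C))
    by (intros; apply analytic_jet, analytic_derive; auto).
  assert (u0 : unit_disk (RtoC 0)) by (unfold unit_disk; rewrite Cmod_0; lra).
  (* Each division by z costs one order: the second tail of f and the first tail of f' must both
     keep order 3. *)
  destruct (jf 5%nat _ u0) as (a & g1 & (b & g2 & jg2 & d1 & hd1 & H1) & d & hd & H).
  destruct (jd 4%nat _ u0) as (a' & k1 & jk1 & d' & hd' & H').
  set (m := Rmin d (Rmin d1 d')).
  assert (hm : 0 < m) by (repeat apply Rmin_pos; trivial).
  assert (md : m <= d) by apply Rmin_l.
  assert (md1 : m <= d1) by (eapply Rle_trans; [apply Rmin_r|apply Rmin_l]).
  assert (md' : m <= d') by (eapply Rle_trans; [apply Rmin_r|apply Rmin_r]).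
  assert (z0m : Cmod (RtoC 0) < m) by now rewrite Cmod_0.
  assert (ea : a = RtoC 0).
  { rewrite <- f0. replace (f (RtoC 0)) with (f (RtoC 0 + RtoC 0)%C) by (f_equal; ring).
    rewrite H by lra. ring. }
  assert (eb : b = RtoC 1).
  { rewrite <- df0. symmetry. refine (proj1 (C_derive_expansion f g2 _ a b m _ hm _)).
    - now do 3 apply jet_pred.
    - intros h hh. rewrite H, H1 by lra. reflexivity. }
  assert (ea' : a' = RtoC 1).
  { rewrite <- df0. replace (C_derive f (RtoC 0)) with (C_derive f (RtoC 0 + RtoC 0)%C)
      by (f_equal; ring). rewrite H' by lra. ring. }
  subst a b a'.
  assert (Ef : forall h, Cmod h < m -> f h = (h * (RtoC 1 + h * g2 h))%C).
  { intros h hh. replace h with (RtoC 0 + h)%C at 1 by ring. rewrite H, H1 by lra. ring. }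
  assert (Ed : forall h, Cmod h < m -> C_derive f h = (RtoC 1 + h * k1 h)%C).
  { intros h hh. replace h with (RtoC 0 + h)%C at 1 by ring. now rewrite H' by lra. }
  set (q := fun z => if Ceq_dec z (RtoC 0) then RtoC 1 else (f z / z)%C).
  set (qd := fun z => if Ceq_dec z (RtoC 0) then (k1 z - g2 z)%C
                      else ((C_derive f z - f z / z) / z)%C).
  exists q, qd. split.
  { unfold q. now destruct (Ceq_dec (RtoC 0) (RtoC 0)). }
  intros z hz. destruct (Ceq_dec z (RtoC 0)) as [e|ne].
  - subst z. repeat split.
    + apply jet_ext with (g := fun h => (RtoC 1 + h * g2 h)%C) (d := m); [exact hm| |].
      * intros h hh. replace (RtoC 0 + h)%C with h by ring. unfold q.
        destruct (Ceq_dec h (RtoC 0)) as [->|nh]; [ring|].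
        rewrite Ef by exact hh. field. exact nh.
      * apply jet_plus; [apply jet_const|]. apply jet_mult; [apply jet_id|exact jg2].
    + apply jet_ext with (g := fun h => (k1 h - g2 h)%C) (d := m); [exact hm| |].
      * intros h hh. replace (RtoC 0 + h)%C with h by ring. unfold qd.
        destruct (Ceq_dec h (RtoC 0)) as [->|nh]; [ring|].
        rewrite Ef, Ed by exact hh. field. exact nh.
      * apply jet_minus; trivial.
    + rewrite f0. ring.
    + rewrite df0. unfold q. destruct (Ceq_dec (RtoC 0) (RtoC 0)); [ring|easy].
  - assert (hz0 : 0 < Cmod z) by now apply Cmod_gt_0.
    assert (nz : forall h, Cmod h < Cmod z -> (z + h)%C <> RtoC 0).
    { intros h hh e. replace z with (- h)%C in hh.
      - rewrite Cmod_opp in hh. lra.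
      - replace z with ((z + h) - h)%C by ring. rewrite e. ring. }
    assert (jz : jet 3 (fun h => (z + h)%C)) by (apply jet_plus; [apply jet_const|apply jet_id]).
    assert (ez : (z + RtoC 0)%C <> RtoC 0) by (apply nz; now rewrite Cmod_0).
    assert (jq : jet 3 (fun h => f (z + h) / (z + h))%C)
      by (apply jet_div; trivial; now apply jf).
    repeat split.
    + apply jet_ext with (g := fun h => (f (z + h) / (z + h))%C) (d := Cmod z); trivial.
      intros h hh. unfold q. destruct (Ceq_dec (z + h) (RtoC 0)) as [e|_]; [|reflexivity].
      now elim (nz h hh).
    + apply jet_ext with
        (g := fun h => ((C_derive f (z + h) - f (z + h) / (z + h)) / (z + h))%C)
        (d := Cmod z); trivial.
      * intros h hh. unfold qd. destruct (Ceq_dec (z + h) (RtoC 0)) as [e|_]; [|reflexivity].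
        now elim (nz h hh).
      * apply jet_div; trivial. apply jet_minus; trivial. now apply jd.
    + unfold q. destruct (Ceq_dec z (RtoC 0)) as [e|_]; [easy|]. field. exact ne.
    + unfold q, qd. destruct (Ceq_dec z (RtoC 0)) as [e|_]; [easy|]. field. exact ne.
Qed.

(** Openness is asked only at points where Re P > alpha, because P = z f'/f need not be continuous
    at zeros of f. It makes the bad set inside |z| <= |w| closed, and -|z| attains its maximum
    there. *)
Lemma first_touch (P : C -> C) (alpha : R) (w : C) :
  (forall z, Cmod z < 1 -> alpha < Re (P z) ->
     exists d, 0 < d /\ forall y, Cmod (y - z) < d -> alpha < Re (P y)) ->
  Cmod w < 1 -> Re (P w) <= alpha ->
  exists z0, Cmod z0 < 1 /\ Re (P z0) <= alpha /\
    forall z, Cmod z < Cmod z0 -> alpha < Re (P z).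
Proof.
  intros hop hw hPw.
  destruct (usc_attains_max (fun z => Cmod z <= Cmod w /\ Re (P z) <= alpha)
    (fun z => - Cmod z) (Cmod w)) as (z0 & [h1 h2] & H).
  - intros z [h _]. exact h.
  - intros z hz. destruct (Rle_dec (Cmod z) (Cmod w)) as [h|h].
    + assert (hP : alpha < Re (P z)) by (apply Rnot_le_lt; intro; apply hz; now split).
      destruct (hop z ltac:(lra) hP) as (d & hd & Hd).
      exists d; split; [exact hd|]. intros y hy [_ hy2]. specialize (Hd y hy). lra.
    + exists (Cmod z - Cmod w); split; [lra|]. intros y hy [hy1 _].
      pose proof (Cmod_triangle_minus y (y - z)) as T.
      replace (y - (y - z))%C with z in T by ring. lra.
  - intros z c _ hc. exists (c + Cmod z); split; [lra|]. intros y _ hy.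
    pose proof (Cmod_triangle_minus y (y - z)) as T.
    replace (y - (y - z))%C with z in T by ring. lra.
  - exists w; split; [lra|exact hPw].
  - exists z0; split; [lra|]. split; [exact h2|]. intros z hz.
    apply Rnot_le_lt. intro hP. assert (hzw : Cmod z <= Cmod w) by lra.
    specialize (H z (conj hzw hP)). simpl in H. lra.
Qed.

(** * Derivatives along a ray and the estimate at the touching point *)

Lemma is_derive_approx (F : R -> R) (t l K d : R) :
  0 < d ->
  (forall s, Rabs s < d -> Rabs (F (t + s) - F t - s * l) <= K * s ^ 2) ->
  is_derive F t l.
Proof.
  intros hd H. apply is_derive_Reals. intros e he.
  set (K1 := Rmax 0 K + 1).
  assert (hK : 0 < K1) by (unfold K1; pose proof (Rmax_l 0 K); lra).
  assert (hm : 0 < Rmin d (e / K1)).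
  { apply Rmin_pos; [exact hd|]. now apply Rdiv_lt_0_compat. }
  exists (mkposreal _ hm). intros s hs hs2. simpl in hs2.
  assert (h1 : Rabs s < d) by (eapply Rlt_le_trans; [exact hs2|apply Rmin_l]).
  assert (h2 : Rabs s < e / K1) by (eapply Rlt_le_trans; [exact hs2|apply Rmin_r]).
  replace ((F (t + s) - F t) / s - l) with ((F (t + s) - F t - s * l) * / s) by (field; exact hs).
  rewrite Rabs_mult, Rabs_inv. pose proof (Rabs_pos_lt s hs) as ps.
  apply Rle_lt_trans with (K1 * Rabs s).
  - apply Rmult_le_reg_r with (Rabs s); [exact ps|].
    rewrite Rmult_assoc, Rinv_l, Rmult_1_r by lra.
    eapply Rle_trans; [now apply H|]. rewrite <- (pow2_abs s).
    pose proof (Rmax_r 0 K). unfold K1. nra.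
  - apply Rmult_lt_compat_l with (r := K1) in h2; [|lra].
    now replace (K1 * (e / K1)) with e in h2 by (field; lra).
Qed.

Lemma is_derive_along_ray (f : C -> C) (z : C) (t : R) :
  jet 2 (fun h => f (RtoC t * z + h)%C) ->
  is_derive (fun t => Re (f (RtoC t * z)%C)) t (Re (z * C_derive f (RtoC t * z))%C) /\
  is_derive (fun t => Im (f (RtoC t * z)%C)) t (Im (z * C_derive f (RtoC t * z))%C).
Proof.
  intro j. destruct (jet2_derive f (RtoC t * z)%C j) as (K & d & hK & hd & H).
  set (L := C_derive f (RtoC t * z)%C) in *.
  assert (hz : 0 < Cmod z + 1) by (pose proof (Cmod_ge_0 z); lra).
  assert (hm : 0 < d / (Cmod z + 1)) by now apply Rdiv_lt_0_compat.
  assert (B : forall s, Rabs s < d / (Cmod z + 1) ->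
    Cmod (f (RtoC (t + s) * z) - f (RtoC t * z) - RtoC s * (z * L))%C
      <= K * Cmod z ^ 2 * s ^ 2).
  { intros s hs. specialize (H (RtoC s * z)%C).
    rewrite Cmod_mult, Cmod_R in H.
    replace (RtoC t * z + RtoC s * z)%C with (RtoC (t + s) * z)%C in H
      by (rewrite RtoC_plus; ring).
    replace (RtoC s * z * L)%C with (RtoC s * (z * L))%C in H by ring.
    eapply Rle_trans; [apply H|].
    - apply Rmult_lt_compat_r with (r := Cmod z + 1) in hs; [|lra].
      replace (d / (Cmod z + 1) * (Cmod z + 1)) with d in hs by (field; lra).
      pose proof (Rabs_pos s). nra.
    - rewrite Rpow_mult_distr, pow2_abs. right. ring. }
  split; apply is_derive_approx with (K := K * Cmod z ^ 2) (d := d / (Cmod z + 1)); trivial;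
    intros s hs; (eapply Rle_trans; [|apply (B s hs)]).
  - replace (Re (f (RtoC (t + s) * z)%C) - Re (f (RtoC t * z)%C) - s * Re (z * L)%C)
      with (Re (f (RtoC (t + s) * z) - f (RtoC t * z) - RtoC s * (z * L))%C)
      by (unfold Re; simpl; ring).
    apply re_le_Cmod.
  - replace (Im (f (RtoC (t + s) * z)%C) - Im (f (RtoC t * z)%C) - s * Im (z * L)%C)
      with (Im (f (RtoC (t + s) * z) - f (RtoC t * z) - RtoC s * (z * L))%C)
      by (unfold Im; simpl; ring).
    apply im_le_Cmod.
Qed.

(* |f| is nondecreasing along a ray where Re (z f'/f) >= 0, so no zero of f
   can be reached from inside. *)
Lemma nonzero_at_end_of_ray (f : C -> C) (z : C) :
  (forall t, 0 < t <= 1 -> jet 2 (fun h => f (RtoC t * z + h)%C)) ->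
  (forall t, 0 < t < 1 -> f (RtoC t * z)%C <> RtoC 0 /\
     0 <= Re (RtoC t * z * C_derive f (RtoC t * z) / f (RtoC t * z))%C) ->
  f z <> RtoC 0.
Proof.
  intros hj hP fz.
  set (df := fun t => (z * C_derive f (RtoC t * z))%C).
  set (F := fun t => (f (RtoC t * z)%C)).
  set (dphi := fun t => 2 * (Re (F t) * Re (df t) + Im (F t) * Im (df t))).
  assert (D : forall t, 0 < t <= 1 ->
    is_derive (fun t => Re (F t) * Re (F t) + Im (F t) * Im (F t)) t (dphi t)).
  { intros t ht. destruct (is_derive_along_ray f z t (hj t ht)) as [D1 D2].
    change (is_derive (fun t => Re (F t)) t (Re (df t))) in D1.
    change (is_derive (fun t => Im (F t)) t (Im (df t))) in D2.
    replace (dphi t) with ((Re (df t) * Re (F t) + Re (F t) * Re (df t))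
      + (Im (df t) * Im (F t) + Im (F t) * Im (df t))) by (unfold dphi; ring).
    exact (is_derive_plus _ _ _ _ _ (is_derive_mult _ _ _ _ _ D1 D1 Rmult_comm)
      (is_derive_mult _ _ _ _ _ D2 D2 Rmult_comm)). }
  (* If f z = 0, then |F|^2 falls from a positive value at 1 / 2 to 0 at 1, against a nonnegative
     derivative. *)
  destruct (MVT_gen (fun t => Re (F t) * Re (F t) + Im (F t) * Im (F t)) (1 / 2) 1 dphi)
    as (c & hc & E).
  - rewrite Rmin_left, Rmax_right by lra. intros t ht. apply D. lra.
  - rewrite Rmin_left, Rmax_right by lra. intros t ht.
    apply derivable_continuous_pt. exists (dphi t). apply is_derive_Reals, D. lra.
  - rewrite Rmin_left, Rmax_right in hc by lra.
    assert (F1 : F 1 = RtoC 0).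
    { unfold F. now replace (RtoC 1 * z)%C with z by ring. }
    assert (nn : 0 <= dphi c).
    (* The mean value point may be the endpoint 1, which [hP] leaves out; there the derivative of
       |F|^2 vanishes together with [F 1]. *)
    { destruct (Req_dec c 1) as [->|nc].
      - unfold dphi. rewrite F1. unfold Re, Im. simpl. lra.
      - destruct (hP c ltac:(lra)) as [N P].
        assert (A : dphi c = 2 / c * Cmod (F c) ^ 2 *
          Re (RtoC c * z * C_derive f (RtoC c * z) / f (RtoC c * z))%C).
        { assert (Q : df c = (RtoC (/ c) * (F c *
            (RtoC c * z * C_derive f (RtoC c * z) / f (RtoC c * z))))%C).
          { unfold df, F. assert (c <> 0) by lra. rewrite RtoC_inv by trivial.
            assert (RtoC c <> RtoC 0) by (intro h; now apply RtoC_inj in h).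
            field. now split. }
          unfold dphi. rewrite Q, Cmod_sqr.
          generalize (RtoC c * z * C_derive f (RtoC c * z) / f (RtoC c * z))%C (F c).
          intros [x1 x2] [y1 y2]. unfold Re, Im. simpl. field. lra. }
        rewrite A. apply Rmult_le_pos; [|exact P].
        apply Rmult_le_pos; [|apply pow2_ge_0].
        left. apply Rdiv_lt_0_compat; lra. }
    rewrite F1 in E.
    destruct (hP (1 / 2) ltac:(lra)) as [N _].
    apply Cmod_gt_0 in N. change (0 < Cmod (F (1 / 2))) in N.
    pose proof (Cmod_sqr (F (1 / 2))) as Q. unfold Re, Im in E. simpl in E, Q.
    pose proof (Rmult_lt_0_compat _ _ N N). nra.
Qed.

(* With W = P(t z0) - 1 and c = 2 (1 - alpha) the hypothesis reads
   |W| <= t |W + c|, while |W + c|^2 - |W|^2 = 2 c (Re P(t z0) - alpha) is at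
   most 2 c s |z0 P'(z0)| + O(s^2) at t = 1 - s. *)
Lemma boundary_derivative_bound (P : C -> C) (z0 : C) (alpha : R) :
  jet 2 (fun h => P (z0 + h)%C) -> alpha < 1 -> Re (P z0) <= alpha ->
  (forall t, 0 < t < 1 -> Cmod (P (RtoC t * z0) - RtoC 1)%C
     <= t * Cmod (P (RtoC t * z0) - RtoC 1 + RtoC (2 * (1 - alpha)))%C) ->
  Cmod (P z0 - RtoC 1) ^ 2 <= 2 * (1 - alpha) * Cmod (z0 * C_derive P z0)%C.
Proof.
  intros j ha hRe H. destruct (jet2_derive P z0 j) as (K & d & hK & hd & HD).
  set (L := (z0 * C_derive P z0)%C) in *.
  set (c := 2 * (1 - alpha)) in *. assert (hc : 0 < c) by (unfold c; lra).
  set (K' := K * Cmod z0 ^ 2).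
  assert (hK' : 0 <= K') by (apply Rmult_le_pos; [exact hK|apply pow2_ge_0]).
  set (w := Cmod (P z0 - RtoC 1)). assert (hw : 0 <= w) by apply Cmod_ge_0.
  assert (hL : 0 <= Cmod L) by apply Cmod_ge_0.
  assert (hz : 0 < Cmod z0 + 1) by (pose proof (Cmod_ge_0 z0); lra).
  (* The inequality at t = 1 - s, already divided by s, with all remaining errors bounded by a
     multiple of s; letting s tend to 0 gives the claim. *)
  assert (S : forall s, 0 < s < 1 -> s < d / (Cmod z0 + 1) ->
    2 * w ^ 2 - 2 * c * Cmod L <= s * (w ^ 2 + 4 * w * (Cmod L + K') + 2 * c * K')).
  { intros s hs hsd.
    specialize (H (1 - s) ltac:(lra)).
    set (h := (- (RtoC s * z0))%C).
    assert (mh : Cmod h = s * Cmod z0).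
    { unfold h. rewrite Cmod_opp, Cmod_mult, Cmod_R, Rabs_pos_eq; lra. }
    assert (eh : (RtoC (1 - s) * z0)%C = (z0 + h)%C)
      by (unfold h; rewrite RtoC_minus; ring).
    rewrite eh in H. specialize (HD h). rewrite mh in HD.
    set (D := (P (z0 + h)%C - P z0)%C).
    assert (hR : Cmod (D + RtoC s * L)%C <= K' * s ^ 2).
    { replace (D + RtoC s * L)%C with (P (z0 + h)%C - P z0 - h * C_derive P z0)%C
        by (unfold D, h, L; ring).
      eapply Rle_trans; [apply HD|unfold K'; right; ring].
      apply Rmult_lt_compat_r with (r := Cmod z0 + 1) in hsd; [|lra].
      replace (d / (Cmod z0 + 1) * (Cmod z0 + 1)) with d in hsd by (field; lra). nra. }
    assert (hDm : Cmod D <= s * (Cmod L + K' * s)).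
    { replace D with (D + RtoC s * L - RtoC s * L)%C by ring.
      eapply Rle_trans; [apply Cmod_triangle_minus|].
      rewrite Cmod_mult, Cmod_R, (Rabs_pos_eq s) by lra. nra. }
    set (W := (P (z0 + h)%C - RtoC 1)%C) in *.
    assert (eW : W = (P z0 - RtoC 1 + D)%C) by (unfold W, D; ring).
    assert (lowW : w ^ 2 - 2 * w * (s * (Cmod L + K' * s)) <= Cmod W ^ 2).
    { pose proof (Cmod_sqr_plus_ge (P z0 - RtoC 1)%C D w (Rle_refl _)) as Q.
      rewrite <- eW in Q. fold w in Q. nra. }
    assert (vw : Cmod (W + RtoC c)%C ^ 2 - Cmod W ^ 2 = c * (2 * Re W + c)).
    { rewrite !Cmod_sqr. destruct W as [w1 w2]. unfold Re. simpl. ring. }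
    assert (reW : 2 * Re W + c <= 2 * (s * (Cmod L + K' * s))).
    { assert (e : Re W = Re (P z0) - 1 + Re D)
        by (rewrite eW; unfold Re; simpl; ring).
      pose proof (re_le_Cmod D). pose proof (Rle_abs (Re D)). unfold c. lra. }
    set (V := Cmod (W + RtoC c)%C) in *.
    pose proof (Cmod_ge_0 W) as pW. assert (pV : 0 <= V) by apply Cmod_ge_0.
    assert (W2 : Cmod W ^ 2 <= (1 - s) ^ 2 * V ^ 2)
      by (rewrite <- Rpow_mult_distr; apply pow_incr; lra).
    assert (WV : Cmod W ^ 2 <= V ^ 2) by (apply pow_incr; nra).
    (* Since |W| <= (1 - s) V, the difference V^2 - |W|^2 is at least s (2 - s) V^2; comparison with
       [vw] and [reW] yields a common factor s. *)
    assert (I1 : s * ((2 - s) * V ^ 2) <= s * (2 * c * (Cmod L + K' * s))) by nra.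
    apply Rmult_le_reg_l in I1; [|lra].
    assert (I2 : (2 - s) * Cmod W ^ 2 <= 2 * c * (Cmod L + K' * s)) by nra.
    assert (I3 : (2 - s) * (w ^ 2 - 2 * w * (s * (Cmod L + K'))) <= 2 * c * (Cmod L + K' * s)).
    { eapply Rle_trans; [|exact I2]. apply Rmult_le_compat_l; [lra|].
      eapply Rle_trans; [|exact lowW].
      apply Rplus_le_compat_l, Ropp_le_contravar. apply Rmult_le_compat_l; [lra|].
      apply Rmult_le_compat_l; [lra|]. nra. }
    assert (0 <= s * s * (2 * w * (Cmod L + K'))).
    { apply Rmult_le_pos; [nra|]. apply Rmult_le_pos; lra. }
    nra. }
  apply Rnot_lt_le. intro N.
  set (T := w ^ 2 + 4 * w * (Cmod L + K') + 2 * c * K') in *.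
  assert (hT : 0 <= T).
  { unfold T. assert (0 <= w * (Cmod L + K')) by (apply Rmult_le_pos; lra).
    assert (0 <= c * K') by (apply Rmult_le_pos; lra). nra. }
  set (g := 2 * w ^ 2 - 2 * c * Cmod L) in *.
  assert (hg : 0 < g) by (unfold g; lra).
  assert (p1 : 0 < d / (Cmod z0 + 1)) by now apply Rdiv_lt_0_compat.
  assert (p2 : 0 < g / (T + 1)) by (apply Rdiv_lt_0_compat; lra).
  set (m := Rmin 1 (Rmin (d / (Cmod z0 + 1)) (g / (T + 1)))).
  assert (hm : 0 < m) by (repeat apply Rmin_pos; trivial; lra).
  assert (m1 : m <= 1) by apply Rmin_l.
  assert (m2 : m <= d / (Cmod z0 + 1)) by (eapply Rle_trans; [apply Rmin_r|apply Rmin_l]).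
  assert (m3 : m <= g / (T + 1)) by (eapply Rle_trans; [apply Rmin_r|apply Rmin_r]).
  specialize (S (m / 2) ltac:(lra) ltac:(lra)).
  apply Rmult_le_compat_r with (r := T + 1) in m3; [|lra].
  replace (g / (T + 1) * (T + 1)) with g in m3 by (field; lra). nra.
Qed.

(** * The power inequality and the conclusion *)

(** All bases are positive, so logarithms make it linear: gamma times 2 ln w <= ln 2 + ln a + ln y
    plus (beta + 2 gamma) times ln a <= ln w. *)
Lemma rpow_lower_bound (w y a beta gamma : R) :
  0 < a <= w -> w ^ 2 <= 2 * a * y -> 0 <= gamma -> 0 <= beta + 2 * gamma ->
  rpow (1 / 2) gamma * rpow a (beta + gamma) <= rpow w beta * rpow y gamma.
Proof.
  intros ha hy hg hbg.
  assert (w2 : 0 < w ^ 2) by (apply pow_lt; lra).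
  assert (py : 0 < y) by nra.
  unfold rpow.
  destruct (Req_dec_T (1 / 2) 0) as [e|_]; [lra|].
  destruct (Req_dec_T a 0) as [e|_]; [lra|].
  destruct (Req_dec_T w 0) as [e|_]; [lra|].
  destruct (Req_dec_T y 0) as [e|_]; [lra|].
  unfold Rpower. rewrite <- !exp_plus.
  assert (E : forall u v, u <= v -> exp u <= exp v).
  { intros u v [h| ->]; [left; now apply exp_increasing|lra]. }
  apply E.
  assert (l1 : ln a <= ln w) by (apply ln_le; lra).
  assert (l2 : 2 * ln w <= ln 2 + ln a + ln y).
  { rewrite <- !ln_mult by lra.
    replace (2 * ln w) with (ln (w ^ 2)) by (simpl; rewrite Rmult_1_r, ln_mult by lra; ring).
    now apply ln_le. }
  replace (ln (1 / 2)) with (- ln 2) by (unfold Rdiv; rewrite Rmult_1_l, ln_Rinv; lra).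
  nra.
Qed.

Theorem theorem3 (f : C -> C) (alpha beta gamma : R)
  (hf : class_A f)
  (halpha : 0 <= alpha < 1)
  (hbg : 0 <= beta + 2 * gamma)
  (hbound : forall z : C, unit_disk z ->
     rpow_defined (Cmod (z * C_derive (log_ratio f) z)%C) gamma /\
     rpow (Cmod (log_ratio f z - RtoC 1)%C) beta *
       rpow (Cmod (z * C_derive (log_ratio f) z)%C) gamma
     < rpow (1 / 2) gamma * rpow (1 - alpha) (beta + gamma)) :
  starlike_of_order alpha f.
Proof.
  split; [exact hf|]. intros w hw. apply Rnot_le_lt. intro hPw.
  assert (hg : 0 <= gamma).
  { apply Rnot_lt_le. intro hg.
    assert (u0 : unit_disk (RtoC 0)) by (unfold unit_disk; rewrite Cmod_0; lra).
    apply (proj1 (hbound _ u0) hg). rewrite Cmult_0_l. apply Cmod_0. }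
  destruct (class_A_quotient f hf) as (q & qd & q0 & Q).
  set (P := log_ratio f) in *.
  assert (P1 : forall z, unit_disk z -> q z <> RtoC 0 ->
    P z = (RtoC 1 + z * qd z / q z)%C).
  { intros z hz nq. destruct (Q z hz) as (_ & _ & e1 & e2). unfold P, log_ratio.
    destruct (Ceq_dec z (RtoC 0)) as [->|nz].
    - unfold Cdiv. ring.
    - rewrite e1, e2. field. now split. }
  (* At a zero z <> 0 of f division by zero gives P z = 0, which alpha >= 0 rules out; at the origin
     q = 1. *)
  assert (P2 : forall z, unit_disk z -> alpha < Re (P z) -> q z <> RtoC 0).
  { intros z hz hP e. destruct (Q z hz) as (_ & _ & e1 & _). unfold P, log_ratio in hP.
    destruct (Ceq_dec z (RtoC 0)) as [->|nz].
    - rewrite q0 in e. apply RtoC_inj in e. lra.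
    - rewrite e1, e, Cmult_0_r in hP. unfold Cdiv in hP.
      replace (/ RtoC 0)%C with (RtoC 0) in hP.
      + rewrite Cmult_0_r in hP. simpl in hP. lra.
      + unfold Cinv, RtoC. simpl. f_equal; unfold Rdiv; ring. }
  assert (jz : forall z, jet 3 (fun h => z + h)%C)
    by (intro; apply jet_plus; [apply jet_const|apply jet_id]).
  assert (P3 : forall z, unit_disk z -> q z <> RtoC 0 -> jet 3 (fun h => P (z + h)%C)).
  { intros z hz nq. destruct (Q z hz) as (jq & jqd & _).
    replace (q z) with (q (z + RtoC 0)%C) in nq by (f_equal; ring).
    destruct (jet1_neq_0 (fun h => q (z + h)%C)) as (d & hd & H);
      [now do 2 apply jet_pred|exact nq|].
    assert (hm : 0 < Rmin d (1 - Cmod z))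
      by (apply Rmin_pos; [exact hd|unfold unit_disk in hz; lra]).
    apply jet_ext with (g := fun h => (RtoC 1 + (z + h) * qd (z + h) / q (z + h))%C)
      (d := Rmin d (1 - Cmod z)); [exact hm| |].
    - intros h hh. symmetry. apply P1.
      + assert (Cmod h < 1 - Cmod z) by (eapply Rlt_le_trans; [exact hh|apply Rmin_r]).
        unfold unit_disk. pose proof (Cmod_triangle z h). lra.
      + apply (H h). eapply Rlt_le_trans; [exact hh|apply Rmin_l].
    - apply jet_plus; [apply jet_const|]. apply jet_div; trivial.
      now apply jet_mult. }
  destruct (first_touch P alpha w) as (z0 & hz0 & hP0 & inside); trivial.
  { intros z hz hP. pose proof (P3 z hz (P2 z hz hP)) as j.
    destruct (jet1_continuous _ (Re (P z) - alpha) (jet_pred _ _ (jet_pred _ _ j)))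
      as (d & hd & H); [lra|].
    exists d; split; [exact hd|]. intros y hy. specialize (H (y - z)%C hy).
    replace (z + (y - z))%C with y in H by ring.
    replace (z + RtoC 0)%C with z in H by ring.
    pose proof (re_le_Cmod (P y - P z)) as R.
    replace (Re (P y - P z)%C) with (Re (P y) - Re (P z)) in R by (unfold Re; simpl; ring).
    pose proof (Rabs_le_between (Re (P y) - Re (P z)) (Cmod (P y - P z))) as I.
    apply I in R. lra. }
  assert (nz0 : z0 <> RtoC 0).
  { intros ->. unfold P, log_ratio in hP0.
    destruct (Ceq_dec (RtoC 0) (RtoC 0)); [simpl in hP0; lra|easy]. }
  set (rho := Cmod z0) in *. assert (hrho : 0 < rho) by now apply Cmod_gt_0.
  assert (mt : forall t, 0 < t -> Cmod (RtoC t * z0) = t * rho).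
  { intros t ht. rewrite Cmod_mult, Cmod_R, Rabs_pos_eq by lra. reflexivity. }
  assert (nq0 : q z0 <> RtoC 0).
  { intro e. apply (nonzero_at_end_of_ray f z0).
    - intros t ht. apply analytic_jet, hf. unfold unit_disk. rewrite mt by lra. nra.
    - intros t ht.
      assert (ut : Cmod (RtoC t * z0) < rho) by (rewrite mt by lra; nra).
      assert (hP := inside _ ut).
      assert (ud : unit_disk (RtoC t * z0)) by (unfold unit_disk; lra).
      assert (nt : (RtoC t * z0)%C <> RtoC 0)
        by (apply Cmod_gt_0; rewrite mt by lra; nra).
      split.
      + destruct (Q _ ud) as (_ & _ & e1 & _). rewrite e1.
        apply Cmult_neq_0; [exact nt|now apply P2].
      + unfold P, log_ratio in hP.
        destruct (Ceq_dec (RtoC t * z0) (RtoC 0)) as [e'|_]; [easy|]. lra.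
    - destruct (Q z0 hz0) as (_ & _ & e1 & _). now rewrite e1, e, Cmult_0_r. }
  set (c := 2 * (1 - alpha)).
  set (D := fun z => (z * qd z + RtoC c * q z)%C).
  assert (inD : forall z, Cmod z < rho -> unit_disk z /\ q z <> RtoC 0 /\
    D z <> RtoC 0 /\ Cmod (z * qd z)%C <= Cmod (D z) /\
    (z * qd z = q z * (P z - RtoC 1))%C /\ (D z = q z * (P z - RtoC 1 + RtoC c))%C).
  { intros z hz. assert (uz : unit_disk z) by (unfold unit_disk; lra).
    assert (hP := inside z hz). assert (nq := P2 z uz hP).
    assert (E1 : (z * qd z = q z * (P z - RtoC 1))%C)
      by (rewrite P1 by trivial; field; exact nq).
    assert (E2 : (D z = q z * (P z - RtoC 1 + RtoC c))%C).
    { unfold D. rewrite E1. ring. }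
    assert (I : Cmod (P z - RtoC 1) <= Cmod (P z - RtoC 1 + RtoC c)).
    { apply Rsqr_incr_0_var; [|apply Cmod_ge_0]. rewrite !Rsqr_pow2, !Cmod_sqr.
      unfold c. destruct (P z) as [p1 p2]. unfold Re in hP. simpl in *. nra. }
    assert (N : (P z - RtoC 1 + RtoC c)%C <> RtoC 0).
    { intro e. apply (f_equal Re) in e. unfold c, Re in *. simpl in e. lra. }
    repeat split; trivial.
    - rewrite E2. now apply Cmult_neq_0.
    - rewrite E1, E2, !Cmod_mult. apply Rmult_le_compat_l; [apply Cmod_ge_0|exact I]. }
  set (G := fun z => (qd z / D z)%C).
  (* The maximum principle is used on closed disks of radius r < rho, since [D] may vanish on |z| =
     rho. On |z| = r the bound 1 / r is |z q'| <= |D|. *)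
  assert (GB : forall r, 0 < r < rho -> forall z, Cmod z <= r -> Cmod (G z) <= / r).
  { intros r hr. apply max_modulus; [lra| |].
    - intros z hz. destruct (inD z ltac:(lra)) as (uz & _ & nD & _).
      destruct (Q z uz) as (jq & jqd & _).
      apply jet_div; trivial.
      + unfold D. apply jet_plus; apply jet_mult; trivial. apply jet_const.
      + now replace (z + RtoC 0)%C with z by ring.
    - intros z hz. destruct (inD z ltac:(lra)) as (_ & _ & nD & I & _).
      rewrite Cmod_mult, hz in I. unfold G. rewrite Cmod_div by exact nD.
      apply Cmod_gt_0 in nD.
      apply Rmult_le_reg_l with r; [lra|]. rewrite Rinv_r by lra.
      apply Rmult_le_reg_r with (Cmod (D z)); [lra|].
      replace (r * (Cmod (qd z) / Cmod (D z)) * Cmod (D z)) with (r * Cmod (qd z))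
        by (field; lra). lra. }
  (* Passage to r = rho: if k = |G z| exceeded 1 / rho, any r strictly between max(|z|, 1 / k) and
     rho would contradict [GB]. *)
  assert (GB' : forall z, Cmod z < rho -> rho * Cmod (G z) <= 1).
  { intros z hz. apply Rnot_lt_le. intro L.
    pose proof (Cmod_ge_0 z) as pz. set (k := Cmod (G z)) in *.
    assert (pk : 0 < k) by nra.
    assert (Ik : / k < rho).
    { apply Rmult_lt_reg_r with k; [exact pk|]. rewrite Rinv_l by lra. lra. }
    assert (pik : 0 < / k) by now apply Rinv_0_lt_compat.
    set (r := (Rmax (Cmod z) (/ k) + rho) / 2).
    assert (h1 : Rmax (Cmod z) (/ k) < rho) by now apply Rmax_lub_lt.
    pose proof (Rmax_l (Cmod z) (/ k)). pose proof (Rmax_r (Cmod z) (/ k)).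
    assert (B := GB r ltac:(unfold r; lra) z ltac:(unfold r; lra)). fold k in B.
    assert (hr : / k < r) by (unfold r; lra).
    apply Rinv_lt_contravar in hr; [|apply Rmult_lt_0_compat; lra].
    rewrite Rinv_inv in hr. lra. }
  assert (J : Cmod (P z0 - RtoC 1) ^ 2 <= 2 * (1 - alpha) * Cmod (z0 * C_derive P z0)%C).
  { apply boundary_derivative_bound; trivial; [|lra|].
    - apply jet_pred. now apply P3.
    - intros t ht. fold c.
      assert (ut : Cmod (RtoC t * z0) < rho) by (rewrite mt by lra; nra).
      destruct (inD _ ut) as (_ & nq & nD & _ & E1 & E2).
      pose proof (GB' _ ut) as B. unfold G in B. rewrite Cmod_div in B by exact nD.
      assert (I : Cmod (RtoC t * z0 * qd (RtoC t * z0)%C) <= t * Cmod (D (RtoC t * z0)%C)).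
      { rewrite Cmod_mult, mt by lra. apply Cmod_gt_0 in nD.
        apply Rmult_le_compat_r with (r := Cmod (D (RtoC t * z0)%C)) in B; [|lra].
        unfold Rdiv in B. rewrite !Rmult_assoc, Rinv_l in B by lra.
        rewrite Rmult_assoc. apply Rmult_le_compat_l; lra. }
      rewrite E1, E2, !Cmod_mult in I. apply Cmod_gt_0 in nq.
      apply Rmult_le_reg_l with (Cmod (q (RtoC t * z0)%C)); [exact nq|]. lra. }
  apply (Rlt_not_le _ _ (proj2 (hbound z0 hz0))).
  apply rpow_lower_bound; trivial. split; [lra|].
  pose proof (re_le_Cmod (P z0 - RtoC 1)) as R.
  pose proof (Rle_abs (- Re (P z0 - RtoC 1))) as A. rewrite Rabs_Ropp in A.
  unfold Re in *. simpl in A, R. lra.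
Qed.
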